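(* (i) If $a,b$ are distinct events of a path $Q$, then there is an event $c\in Q$ such that $[a\;b\;c]$. (ii) Each path contains an infinite set of distinct events.
   Context: Let $\mathcal E$ be a set, whose elements are called events; let $\mathcal P$ be a set of subsets of $\mathcal E$, whose elements are called paths; and let $[\,\cdot\;\cdot\;\cdot\,]$ be a ternary relation (betweenness) on $\mathcal E$. Definitions. A finite chain is a sequence $(q_0,\dots,q_n)$ of events, $n\ge1$, such that: if $n=1$, then $q_0\ne q_1$ and some path contains both; if $n\ge2$, then $[q_i\;q_j\;q_k]$ for all $0\le i<j<k\le n$. An infinite chain is a sequence $(q_i)_{i\in\mathbb N}$ of events with $[q_i\;q_j\;q_k]$ for all $i<j<k$. A bound of an infinite chain is an event $q$ with $[q_i\;q_j\;q]$ for all $i<j$; a closest bound is a bound $q$ such that $[q_0\;q\;q']$ for every bound $q'\ne q$. For a path $Q$ and an event $b\notin Q$, the unreachable subset of $Q$ from $b$ is $Q(b,\emptyset)=\{x\in Q:\text{ no path contains both } b \text{ and } x\}$. For distinct paths $Q,R$ meeting at $x$ and $Q_a\in Q$, $Q(Q_a,R,x,\emptyset)=\{y: [x\;y\;Q_a]\text{ and there is } w\in R \text{ (}w\notin Q\text{) with } Q_a,y\in Q(w,\emptyset)\}$. $\mathrm{SPRAY}[x]$ is the set of paths containing the event $x$. Three distinct paths of $\mathrm{SPRAY}[x]$ are dependent if some path not in $\mathrm{SPRAY}[x]$ meets each of the three; then each is said to be dependent on the set of the other two. Inductively, a path $T$ is dependent on a set $S\subseteq\mathrm{SPRAY}[x]$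 with $n\ge3$ elements if $T$ is dependent on a set of two paths $\{S_1,S_2\}$, each of which is dependent on some subset of $S$ with $n-1$ elements. A set of paths is dependent if it contains a path $P$ and a subset not containing $P$ on which $P$ is dependent (for some $x$); it is independent if it has no dependent subset. $\mathrm{SPRAY}[x]$ is a 3-SPRAY if it contains four distinct paths forming an independent set such that every path of $\mathrm{SPRAY}[x]$ is dependent on the set of these four. The following axioms are assumed. (I1) $\mathcal E\neq\emptyset$. (I2) For distinct events $a,b$ there are paths $R\ni a$, $S\ni b$ with $R\cap S\ne\emptyset$. (I3) For any two distinct events there is at most one path containing both. (I4) If $\mathcal E\ne\emptyset$, there is at least one 3-SPRAY. (O1) If $[a\;b\;c]$ then some path contains $a,b,c$. (O2) $[a\;b\;c]\Rightarrow[c\;b\;a]$. (O3) $[a\;b\;c]\Rightarrow a\neq c$. (O4) $[a\;b\;c]$ and $[b\;c\;d]$ imply $[a\;b\;d]$ (no distinctness of $a,d$ is assumed). (O5) If $a,b,c$ are distinct events of one path, then $[a\;b\;c]$ or $[b\;c\;a]$ or $[c\;a\;b]$. (O6) If $Q,R,S$ are distinct paths, $T$ is a path, $a\in Q\cap R$, $b\in Q\cap S$, $c\in R\cap S$, and there are $d\in S$ with $[b\;c\;d]$ and $e\in R$ with $[c\;e\;a]$ and $d,e\in T$, then there is $f\in T\cap Q$ belonging to a finite chain with first event $a$ and last event $b$, where $a,f,b$ are distinct. (I5) For any path $Q$ and event $b\notin Q$, the set $Q(b,\emptyset)$ contains at least two events. (I6) For any path $Q$, event $b\notin Q$ and distinct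 $Q_x,Q_z\in Q(b,\emptyset)$ there is a finite chain $(q_0,\dots,q_n)$ with $q_0=Q_x$, $q_n=Q_z$ such that for all $i\in\{1,\dots,n\}$: $q_i\in Q(b,\emptyset)$, and every event $y$ with $[q_{i-1}\;y\;q_i]$ lies in $Q(b,\emptyset)$. (I7) For any path $Q$, event $b\notin Q$, $Q_x\in Q\setminus Q(b,\emptyset)$ and $Q_y\in Q(b,\emptyset)$ there is a finite chain $(q_0,\dots,q_n)$ and $0<m<n$ with $q_0=Q_x$, $q_m=Q_y$ and $q_n\in Q\setminus Q(b,\emptyset)$. (S) If $Q,R,S$ are distinct paths with $x\in Q\cap R\cap S$, and $Q_a\in Q\setminus\{x\}$ satisfies $Q(Q_a,R,x,\emptyset)=Q(Q_a,S,x,\emptyset)$, then there is a map $\theta:\mathcal E\to\mathcal E$ such that $P\mapsto\theta(P)$ (direct image) is a bijection $\mathcal P\to\mathcal P$, $\theta(y)=y$ for all $y\in Q$, and $\theta(R)=S$. (C) Every infinite chain that has a bound has a closest bound. *)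

(* Defs.v *)
From mathcomp Require Import all_boot.
From mathcomp Require Import boolp classical_sets functions cardinality.

Set Implicit Arguments.
Unset Strict Implicit.
Unset Printing Implicit Defensive.

Local Open Scope classical_set_scope.
Local Open Scope card_scope.

(* The primitive notions, with no axiom imposed. *)
Record geometry := Geometry {
  event : Type;
  paths : set (set event);
  btw : event -> event -> event -> Prop
}.

(* The finite sequence (q_0, ..., q_n) is given by q : nat -> event G together
   with n; the values of q beyond n are irrelevant. *)
Definition finite_chain (G : geometry) (n : nat) (q : nat -> event G) : Prop :=
  [/\ 1 <= n,
      n = 1 -> q 0 <> q 1 /\ (exists Q, [/\ paths Q, Q (q 0) & Q (q 1)])
    & 2 <= n ->
      forall i j k, i < j -> j < k -> k <= n -> btw (q i) (q j) (q k)].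

Definition infinite_chain (G : geometry) (q : nat -> event G) : Prop :=
  forall i j k, i < j -> j < k -> btw (q i) (q j) (q k).

Definition bound (G : geometry) (q : nat -> event G) (b : event G) : Prop :=
  forall i j, i < j -> btw (q i) (q j) b.

Definition closest_bound (G : geometry) (q : nat -> event G) (b : event G) :
    Prop :=
  bound q b /\ forall b', bound q b' -> b' <> b -> btw (q 0) b b'.

(* Q(b, set0), meaningful when Q is a path and b is not in Q. *)
Definition unreachable (G : geometry) (Q : set (event G)) (b : event G) :
    set (event G) :=
  [set y | Q y /\ ~ exists R, [/\ paths R, R b & R y]].

(* Q(a, R, x, set0), meaningful when Q and R are distinct paths meeting at x
   and a is in Q. *)
Definition unreachable_via (G : geometry) (Q : set (event G)) (a : event G)
    (R : set (event G)) (x : event G) : set (event G) :=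
  [set y | btw x y a /\
     exists w, [/\ R w, ~ Q w, unreachable Q w a & unreachable Q w y]].

Definition spray (G : geometry) (x : event G) : set (set (event G)) :=
  [set Q | paths Q /\ Q x].

Definition dependent3 (G : geometry) (x : event G) (Q R S : set (event G)) :
    Prop :=
  [/\ [/\ spray x Q, spray x R & spray x S],
      [/\ Q <> R, Q <> S & R <> S]
    & exists T, [/\ paths T /\ ~ spray x T,
                    T `&` Q !=set0, T `&` R !=set0 & T `&` S !=set0]].

Inductive dependent_on (G : geometry) (x : event G) :
    set (event G) -> set (set (event G)) -> Prop :=
| dependent_on_pair T S1 S2 :
    dependent3 x T S1 S2 -> dependent_on x T [set S1; S2]
| dependent_on_step n T S S1 S2 A1 A2 :
    3 <= n -> S `<=` spray x -> S #= `I_n ->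
    dependent3 x T S1 S2 ->
    A1 `<=` S -> A1 #= `I_n.-1 -> dependent_on x S1 A1 ->
    A2 `<=` S -> A2 #= `I_n.-1 -> dependent_on x S2 A2 ->
    dependent_on x T S.

Definition dependent (G : geometry) (D : set (set (event G))) : Prop :=
  exists x T S, [/\ D T, S `<=` D, ~ S T & dependent_on x T S].

Definition independent (G : geometry) (D : set (set (event G))) : Prop :=
  forall D', D' `<=` D -> ~ dependent D'.

Definition three_spray (G : geometry) (x : event G) : Prop :=
  exists Q1 Q2 Q3 Q4,
    [/\ [/\ spray x Q1, spray x Q2, spray x Q3 & spray x Q4],
        [/\ Q1 <> Q2, Q1 <> Q3 & Q1 <> Q4] /\
          [/\ Q2 <> Q3, Q2 <> Q4 & Q3 <> Q4],
        independent [set Q1; Q2; Q3; Q4]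
      & forall T, spray x T -> dependent_on x T [set Q1; Q2; Q3; Q4]].

Record minkowski_axioms (G : geometry) : Prop := MinkowskiAxioms {
  axI1 : [set: event G] !=set0;
  axI2 : forall a b : event G, a <> b ->
    exists R S, [/\ paths R, paths S, R a, S b & R `&` S !=set0];
  axI3 : forall (a b : event G) Q R, a <> b -> paths Q -> paths R ->
    Q a -> Q b -> R a -> R b -> Q = R;
  axI4 : [set: event G] !=set0 -> exists x : event G, three_spray x;
  axO1 : forall a b c : event G, btw a b c ->
    exists Q, [/\ paths Q, Q a, Q b & Q c];
  axO2 : forall a b c : event G, btw a b c -> btw c b a;
  axO3 : forall a b c : event G, btw a b c -> a <> c;
  axO4 : forall a b c d : event G, btw a b c -> btw b c d -> btw a b d;
  axO5 : forall (Q : set (event G)) a b c, paths Q -> Q a -> Q b -> Q c ->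
    a <> b -> b <> c -> a <> c -> [\/ btw a b c, btw b c a | btw c a b];
  axO6 : forall (Q R S T : set (event G)) a b c d e,
    paths Q -> paths R -> paths S -> paths T ->
    Q <> R -> Q <> S -> R <> S ->
    Q a -> R a -> Q b -> S b -> R c -> S c ->
    S d -> btw b c d -> R e -> btw c e a -> T d -> T e ->
    exists f n q, [/\ T f /\ Q f,
      [/\ finite_chain n q, q 0 = a & q n = b],
      exists2 i, i <= n & q i = f
      & [/\ a <> f, f <> b & a <> b]];
  axI5 : forall (Q : set (event G)) b, paths Q -> ~ Q b ->
    exists y z, [/\ y <> z, unreachable Q b y & unreachable Q b z];
  axI6 : forall (Q : set (event G)) b y z, paths Q -> ~ Q b ->
    unreachable Q b y -> unreachable Q b z -> y <> z ->
    exists n q, [/\ finite_chain n q, q 0 = y, q n = z &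
      forall i, 1 <= i <= n -> unreachable Q b (q i) /\
        forall u, btw (q i.-1) u (q i) -> unreachable Q b u];
  axI7 : forall (Q : set (event G)) b y z, paths Q -> ~ Q b ->
    Q y -> ~ unreachable Q b y -> unreachable Q b z ->
    exists n m q, [/\ finite_chain n q, 0 < m < n, q 0 = y, q m = z &
      Q (q n) /\ ~ unreachable Q b (q n)];
  axS : forall (Q R S : set (event G)) x a,
    paths Q -> paths R -> paths S -> Q <> R -> Q <> S -> R <> S ->
    Q x -> R x -> S x -> Q a -> a <> x ->
    unreachable_via Q a R x = unreachable_via Q a S x ->
    exists theta : event G -> event G,
      [/\ set_bij (@paths G) (@paths G) (fun A => theta @` A),
          forall y, Q y -> theta y = y
        & theta @` R = S];
  axC : forall q : nat -> event G, infinite_chain q ->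
    (exists b, bound q b) -> exists b, closest_bound q b
}.

(* Main.v *)
Require Import Defs.
From mathcomp Require Import all_boot.
From mathcomp Require Import boolp classical_sets functions cardinality.

Local Open Scope classical_set_scope.

(* For (i), take a path R other than Q through a.  Since b is not on R, some
   event e of R is unreachable from b; thus b, but not a, lies in the unreachable
   subset of Q from e, and (I7) puts an event of Q beyond b as seen from a.
   To find R, note that some event is off Q, since a path containing all events
   would be the only path by (I5) and (I3).  By (I2), either R exists or some
   other path S meets Q.  If S meets Q at f <> a, then (I7) on S, with respect
   to a, gives an event of S other than f that is joined to a.
   For (ii), iterate (i); (O4) makes the resulting events distinct. *)

Section Prolongation.
Set Implicit Arguments.
Unset Strict Implicit.
Variables (G : geometry) (ax : minkowski_axioms G).
Implicit Types (Q R S : set (event G)) (a b c e y z : event G).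

(** If [a = b], then (O4) applied to [btw c a a] and [btw a a c] yields [btw c a c], against
    (O3). *)
Lemma btw_neq12 a b c : btw a b c -> a <> b.
Proof.
move=> abc ab; rewrite -ab in abc.
have caa := axO2 ax abc.
exact: (axO3 ax (axO4 ax caa abc)).
Qed.

Lemma btw_neq23 a b c : btw a b c -> b <> c.
Proof. by move=> /(axO2 ax)/btw_neq12/nesym. Qed.

Lemma btw_path Q a b c : paths Q -> Q a -> Q b -> btw a b c -> Q c.
Proof.
move=> pQ Qa Qb abc; have [R [pR Ra Rb Rc]] := axO1 ax abc.
by rewrite (axI3 ax (btw_neq12 abc) pQ pR Qa Qb Ra Rb).
Qed.

Lemma event_off_path Q : paths Q -> exists e, ~ Q e.
Proof.
move=> pQ; apply/setTPn/eqP => QT.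
have eqQ R : paths R -> R = Q.
  move=> pR; have [RT|/eqP/setTPn[b nRb]] := pselect (R = setT).
    by rewrite RT QT.
  have [y [z [yz [Ry _] [Rz _]]]] := axI5 ax pR nRb.
  by apply: (axI3 ax yz pR pQ) => //; rewrite QT.
(* (I4) is used only as a source of two distinct paths. *)
have [x [Q1 [Q2 [Q3 [Q4 [[[p1 _] [p2 _] _ _] [[n12 _ _] _] _ _]]]]]] :=
  axI4 ax (axI1 ax).
by apply: n12; rewrite (eqQ _ p1) (eqQ _ p2).
Qed.

Lemma path_two_events Q : paths Q -> exists a b, [/\ Q a, Q b & a <> b].
Proof.
move=> pQ; have [e nQe] := event_off_path pQ.
by have [y [z [yz [Qy _] [Qz _]]]] := axI5 ax pQ nQe; exists y, z.
Qed.

Lemma reachable_beyond Q e y z : paths Q -> ~ Q e ->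
  Q y -> ~ unreachable Q e y -> unreachable Q e z ->
  exists c, [/\ btw y z c, Q c & ~ unreachable Q e c].
Proof.
move=> pQ nQe Qy ry uz.
have [n [m [q [[_ _ ch] /andP[m0 mn] <- <- [Qc rc]]]]] :=
  axI7 ax pQ nQe Qy ry uz.
(* Since [0 < m < n] forces [2 <= n], the chain is ordered by betweenness at [0], [m], [n]. *)
by exists (q n); split=> //; apply: ch => //; apply: leq_ltn_trans mn.
Qed.

Lemma reachable_path Q e y : Q y -> ~ unreachable Q e y ->
  exists R, [/\ paths R, R e & R y].
Proof. by move=> Qy ry; apply: contrapT => nR; apply: ry. Qed.

Lemma crossing_path Q a : paths Q -> Q a ->
  exists R, [/\ paths R, R a & R <> Q].
Proof.
move=> pQ Qa; have [e nQe] := event_off_path pQ.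
have ae : a <> e by move=> ae; rewrite ae in Qa.
have [R [S [pR pS Ra Se [f [Rf Sf]]]]] := axI2 ax ae.
have [RQ|RQ] := pselect (R = Q); last by exists R.
rewrite {}RQ {pR Ra} in Rf.
have SQ : S <> Q by move=> SQ; rewrite SQ in Se.
have [Sa|nSa] := pselect (S a); first by exists S.
have [y [_ [_ uy _]]] := axI5 ax pS nSa.
have rf : ~ unreachable S a f by case=> _; apply; exists Q.
have [c [fyc Sc rc]] := reachable_beyond pS nSa Sf rf uy.
have [T [pT Ta Tc]] := reachable_path Sc rc.
exists T; split=> // TQ; rewrite TQ in Tc.
(* Otherwise [S] and [Q] would share the distinct events [f] and [c]. *)
exact/SQ/(axI3 ax (axO3 ax fyc)).
Qed.

Lemma prolongation Q a b : paths Q -> Q a -> Q b -> a <> b ->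
  exists2 c, Q c & btw a b c.
Proof.
move=> pQ Qa Qb ab; have [R [pR Ra RQ]] := crossing_path pQ Qa.
have nRb : ~ R b by move=> Rb; apply: RQ; exact: (axI3 ax ab).
(* Being joined by no path is symmetric, so [b] and [e] can exchange roles below. *)
have [e [_ [_ [Re nbe] _]]] := axI5 ax pR nRb.
have nQe : ~ Q e by move=> Qe; apply: nbe; exists Q.
have ra : ~ unreachable Q e a by case=> _; apply; exists R.
have ub : unreachable Q e b.
  by split=> // -[T [pT Te Tb]]; apply: nbe; exists T.
by have [c [abc Qc _]] := reachable_beyond pQ nQe Qa ra ub; exists c.
Qed.

Lemma prolongation_seq Q : paths Q ->
  exists q : nat -> event G,
    (forall n, Q (q n)) /\ forall n, btw (q n) (q n.+1) (q n.+2).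
Proof.
move=> pQ; have [a [b [Qa Qb ab]]] := path_two_events pQ.
pose ok (p : event G * event G) := [/\ Q p.1, Q p.2 & p.1 <> p.2].
have /choice[next nextP] p : exists c, ok p -> btw p.1 p.2 c.
  (* Choice needs a total function; the value [a] on bad pairs is arbitrary. *)
  have [[Qy Qz yz]|nok] := pselect (ok p); last by exists a => /nok.
  by have [c _ yzc] := prolongation pQ Qy Qz yz; exists c.
pose s n := iter n (fun p => (p.2, next p)) (a, b).
have okS p : ok p -> ok (p.2, next p).
  move=> okp; have yzc := nextP _ okp; case: (okp) => Qy Qz yz.
  by split=> //=; [exact: btw_path yzc|exact: btw_neq23 yzc].
have oks n : ok (s n) by elim: n => [|n IHn] //=; exact: okS.
exists (fun n => (s n).1); split=> n; first by case: (oks n).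
exact: nextP (oks n).
Qed.

Lemma btw_seq_trans (q : nat -> event G) :
  (forall n, btw (q n) (q n.+1) (q n.+2)) ->
  forall i j, i < j -> btw (q i) (q j) (q j.+1).
Proof.
move=> qP i; elim=> // j IHj; rewrite ltnS leq_eqVlt => /predU1P[<-|/IHj qij].
  exact: qP.
(* (O4) moves the third event outward; reversing both triples by (O2) gives the form that keeps
   [q i] and drops [q j]. *)
by apply: (axO2 ax); apply: (axO4 ax); apply: (axO2 ax); [exact: qP|exact: qij].
Qed.

Lemma btw_seq_inj (q : nat -> event G) :
  (forall n, btw (q n) (q n.+1) (q n.+2)) -> injective q.
Proof.
move=> qP i j qij; have lt_neq m n : m < n -> q m <> q n.
  by move=> /(btw_seq_trans qP)/btw_neq12.
by case: (ltngtP i j) => // /lt_neq; rewrite qij.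
Qed.

End Prolongation.

Theorem theorem6 (G : geometry) (ax : minkowski_axioms G) :
  (forall (Q : set (event G)) (a b : event G),
     paths Q -> Q a -> Q b -> a <> b -> exists2 c, Q c & btw a b c) /\
  (forall Q : set (event G),
     paths Q -> exists2 A : set (event G), A `<=` Q & infinite_set A).
Proof.
split=> [Q a b|Q pQ]; first exact: prolongation.
have [q [Qq qP]] := prolongation_seq ax pQ.
exists (range q); first by move=> _ [n _ <-].
have q_inj := btw_seq_inj ax qP.
have eq_q : (range q #= [set: nat])%card by apply: inj_card_eq => m n _ _; exact: q_inj.
by rewrite (eq_finite_set eq_q); exact: infinite_nat.
Qed.
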